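(* Let $\mathscr{D}$ be a nonnegative integer-valued random variable with $\mathbb{P}(\mathscr{D}>t)=\mathcal{L}(t)t^{-\gamma}$, $\mathcal{L}$ slowly varying, $1<\gamma<2$. Let $D_1,\dots,D_n$ be i.i.d. copies, $G_n$ the configuration model with these degrees and $Z_n$ the number of edges removed when forming the erased configuration model from $G_n$. Then for every $\delta>0$, $Z_n/n^{2-\gamma+\delta}\to0$ in probability.
   Context: Configuration model: vertex $i$ gets $D_i$ half-edges (one added if the sum is odd; ignored), paired uniformly at random; $X_{ij}$ is the number of edges between $i\ne j$ and $X_{ii}$ the number of self-loops at $i$. The erased configuration model removes self-loops and merges multiple edges; the number of removed edges is $Z_n=\sum_{i=1}^nX_{ii}+\sum_{1\le i<j\le n}(X_{ij}-\mathbf 1\{X_{ij}>0\})$. *)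

(* Defs.v *)
From HB Require Import structures.
From mathcomp Require Import all_boot all_order all_algebra all_fingroup.
From mathcomp Require Import all_classical all_reals all_analysis.
Set Implicit Arguments. Unset Strict Implicit. Unset Printing Implicit Defensive.
Import Order.TTheory GRing.Theory Num.Theory numFieldNormedType.Exports.
Local Open Scope ring_scope.
Local Open Scope classical_set_scope.

Definition slowly_varying (R : realType) (L : R -> R) : Prop :=
  measurable_fun [set: R] L /\
  (\forall x \near +oo, 0 < L x) /\
  (forall a : R, 0 < a -> (L (a * x) / L x) @[x --> +oo] --> (1 : R)).

Definition adj_deg (n : nat) (d : 'I_n -> nat) (i : 'I_n) : nat :=
  d i + (odd (\sum_(j < n) d j) && (i.+1 == n)).

Definition half_edge (n : nat) (d : 'I_n -> nat) : finType :=
  {i : 'I_n & 'I_(adj_deg d i)}.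

(* A configuration = perfect matching of half-edges = fixed-point-free involution. *)
Definition is_pairing (T : finType) (m : {perm T}) : bool :=
  [forall x, (m (m x) == x) && (m x != x)].

(* Number of half-edges at i paired with a half-edge at j.
   For i <> j this is X_ij; for i = j it is 2 X_ii. *)
Definition half_count (n : nat) (d : 'I_n -> nat) (m : {perm half_edge d})
  (i j : 'I_n) : nat :=
  #|[set h : half_edge d | (tag h == i) && (tag (m h) == j)]|.

Definition X_edges (n : nat) (d : 'I_n -> nat) (m : {perm half_edge d})
  (i j : 'I_n) : nat :=
  if i == j then (half_count m i i)./2 else half_count m i j.

Definition removed_edges (n : nat) (d : 'I_n -> nat) (m : {perm half_edge d}) : nat :=
  (\sum_(i < n) X_edges m i i +
   \sum_(i < n) \sum_(j < n | i < j) (X_edges m i j - (0 < X_edges m i j)))%N.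

Definition pairing_prob (R : realType) (n : nat) (d : 'I_n -> nat)
  (E : nat -> bool) : R :=
  (#|[set m : {perm half_edge d} | is_pairing m && E (removed_edges m)]|%:R /
   #|[set m : {perm half_edge d} | is_pairing m]|%:R).

Definition CM_prob (R : realType) (p : nat -> R) (n : nat) (E : nat -> bool) : \bar R :=
  (\esum_(d in [set: {ffun 'I_n -> nat}])
     ((\prod_(i < n) p (d i)) * pairing_prob R d E)%:E)%E.

(* Main.v *)
(** Fix [s] in [[1, gamma)] with [gamma - s < delta].  Given the degrees, with [N] half-edges,
    symmetry under conjugation by transpositions gives
    [E X_ij <= d_i d_j / (N - 1)] and [E (X_ij - 1)^+ <= (d_i d_j)^2 / ((N - 1) (N - 3))].
    If [N >= c n], then [min (u, u^2) <= u^s] bounds the conditional mean of [Z_n] by a constant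
    times [n^(1 - s) sum_i b_i^s + n^(- s) sum_(i != j) b_i^s b_j^s], where [b_i = d_i + 1] also
    absorbs the half-edge added for parity.  The [s]-th moment of the degree is finite because
    slow variation makes its dyadic tails decay geometrically, so the mean of [Z_n] over this
    event is [O(n^(2 - s))] and Markov's inequality applies.  The event [sum_i d_i < c n] is
    exponentially unlikely by a Chernoff bound. *)
Require Import Defs.
From HB Require Import structures.
From mathcomp Require Import all_boot all_order all_algebra all_fingroup.
From mathcomp Require Import all_classical all_reals all_analysis.
From mathcomp Require Import lra ring zify.
Import Order.TTheory GRing.Theory Num.Theory numFieldNormedType.Exports.
Set Implicit Arguments. Unset Strict Implicit. Unset Printing Implicit Defensive.
Local Open Scope ring_scope.
Local Open Scope classical_set_scope.

(** * Counting perfect matchings that contain prescribed pairs *)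

Section PairingCounts.
Variable T : finType.
Implicit Types (m s : {perm T}) (h y : T) (A : {set {perm T}}) (F : {set T}).

Definition pairings : {set {perm T}} := [set m | is_pairing m]%SET.

Lemma pairings_conjg m s : m \in pairings -> (m ^ s)%g \in pairings.
Proof.
rewrite !inE => /forallP mP; apply/forallP => x.
have conjE z : (m ^ s)%g z = s (m ((s^-1)%g z)) by rewrite conjgE !permM.
have /andP[/eqP mm mx] := mP ((s^-1)%g x).
rewrite !conjE permK mm permKV eqxx /=.
by apply: contra mx => /eqP {2}<-; rewrite permK.
Qed.

(* Conjugation by the transposition (y y0) shows that h is matched equally often to every y in F. *)
Lemma card_image_le A F h y0 :
  h != y0 -> h \notin F ->
  (forall y m, y \in F -> m \in A -> (m ^ tperm y y0)%g \in A) ->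
  (#|F| * #|[set m in A | m h == y0]%SET| <= #|A|)%N.
Proof.
move=> hy0 hF Aconj; rewrite -sum_nat_const.
have le1 y : y \in F ->
    (#|[set m in A | m h == y0]%SET| <= #|[set m in A | m h == y]%SET|)%N.
  move=> yF; rewrite -(card_imset _ (conjg_inj (tperm y y0))).
  apply: subset_leq_card; apply/fintype.subsetP => m' /imsetP[m].
  rewrite inE => /andP[mA /eqP mh] ->; rewrite inE Aconj //=.
  have yh : y != h by apply: contraNneq hF => <-.
  by rewrite conjgE !permM tpermV (tpermD yh) ?mh ?tpermR // eq_sym.
apply: (@leq_trans (\sum_(y in F) #|[set m in A | m h == y]%SET|)%N).
  exact: leq_sum.
rewrite -[#|A|]sum1_card (partition_big (fun m => m h) predT) //=.
rewrite [leqRHS](bigID (mem F)) /= (leq_trans _ (leq_addr _ _)) //.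
apply: leq_sum => y yF; rewrite -sum1_card; apply: eq_leq.
by apply: eq_bigl => m; rewrite inE.
Qed.

(** A pairing has no fixed point, so [h = y] gives the empty set; otherwise all [#|T| - 1] partners
    other than [h] are equally frequent. *)
Lemma card_pairings1 h y : 
  (#|T|.-1 * #|[set m in pairings | m h == y]%SET| <= #|pairings|)%N.
Proof.
have [->|hy] := eqVneq h y.
  rewrite (_ : [set m in _ | _]%SET = finset.set0) ?cards0 ?muln0 //.
  apply/setP => m; rewrite !inE; apply/negbTE/negP => /andP[/forallP mP /eqP my].
  by have := mP y; rewrite !my eqxx.
rewrite -(cardsC1 h); apply: card_image_le => //; first by rewrite !inE eqxx.
by move=> z m _; exact: pairings_conjg.
Qed.

(** Restrict to pairings with [m h1 = y1]. Conjugation by [tperm y y2] fixes [h1] and [y1], hence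
    preserves this class, as long as [y] avoids [h1], [h2], [y1]; this leaves at least [#|T| - 3]
    equally frequent partners for [h2]. If [y1 = y2], injectivity makes the set empty. *)
Lemma card_pairings2 h1 h2 y1 y2 : uniq [:: h1; h2; y1] -> y2 \notin [:: h1; h2] ->
  (#|T|.-1 * (#|T| - 3) *
     #|[set m in pairings | (m h1 == y1) && (m h2 == y2)]%SET| <= #|pairings|)%N.
Proof.
move=> uh; rewrite !inE => /norP[y2h1 y2h2].
apply: (leq_trans _ (card_pairings1 h1 y1)).
rewrite -mulnA leq_mul2l; apply/orP; right.
have [y12|y12] := eqVneq y1 y2.
  rewrite (_ : [set m in _ | _]%SET = finset.set0) ?cards0 ?muln0 //.
  apply/setP => m; rewrite !inE; apply/negbTE/negP => /and3P[_ /eqP m1 /eqP m2].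
  move: uh; rewrite /= !inE => /andP[/norP[/eqP + _] _]; apply.
  by apply: (@perm_inj _ m); rewrite m1 m2.
set F := ~: [set h1; h2; y1]%SET.
have cF : (#|T| - 3 <= #|F|)%N.
  rewrite cardsCs finset.setCK leq_sub2l //.
  apply: leq_trans (card_size [:: h1; h2; y1]).
  by apply: eq_leq; apply: eq_card => x; rewrite !inE orbA.
apply: leq_trans (leq_mul cF (leqnn _)) _.
rewrite (_ : [set m in pairings | (m h1 == y1) && (m h2 == y2)]%SET =
   [set m in [set m in pairings | m h1 == y1]%SET | m h2 == y2]%SET); last first.
  by apply/setP => m; rewrite !inE andbA.
apply: card_image_le; first by rewrite eq_sym.
  by rewrite !inE eqxx orbT.
move=> y m; rewrite !inE => /norP[/norP[yh1 yh2] yy1] /andP[mP /eqP mh].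
have := pairings_conjg (tperm y y2) (_ : m \in pairings); rewrite !inE => -> //=.
by rewrite conjgE !permM tpermV (tpermD yh1 y2h1) mh tpermD // eq_sym.
Qed.

End PairingCounts.

(** * Sums over all pairings of edge counts and of excess edge counts *)

Section EdgeCounts.
Variables (n : nat) (d : 'I_n -> nat).
Let N := #|half_edge d|.
Let P := pairings (half_edge d).

Definition half_edges_at (i : 'I_n) : {set half_edge d} := [set h | tag h == i]%SET.

Lemma card_half_edges_at i : #|half_edges_at i| = adj_deg d i.
Proof.
rewrite -[RHS]card_ord.
pose g (k : 'I_(adj_deg d i)) : half_edge d := Tagged (fun i => 'I_(adj_deg d i)) k.
have gi : injective g by move=> k k' /eqP; rewrite eq_Tagged => /eqP.
rewrite -(card_codom gi); apply: eq_card => h; rewrite inE.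
apply/eqP/codomP => [|[k ->]//].
by case: h => j k /= ji; subst j; exists k.
Qed.

Lemma card_half_edge : N = (\sum_(i < n) adj_deg d i)%N.
Proof. by rewrite /N card_tagged sumnE big_map big_enum; apply: eq_bigr => i _; rewrite card_ord. Qed.

(** Passes from the classical set in [half_count] to a finite set. *)
Lemma half_count_card (m : {perm half_edge d}) i j : half_count m i j =
  #|[set h : half_edge d | (tag h == i) && (tag (m h) == j)]%SET|.
Proof.
rewrite /half_count; apply: eq_card => h; rewrite [RHS]inE.
by apply/idP/idP => [/set_mem|/mem_set].
Qed.

Lemma half_count_le (m : {perm half_edge d}) i j : (half_count m i j <= adj_deg d i)%N.
Proof.
rewrite half_count_card -card_half_edges_at; apply: subset_leq_card; apply/fintype.subsetP => h.
by rewrite !inE => /andP[].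
Qed.

Lemma half_countE (m : {perm half_edge d}) i j :
  half_count m i j =
  (\sum_(h in half_edges_at i) \sum_(y in half_edges_at j) (m h == y))%N.
Proof.
rewrite half_count_card -sum1_card big_mkcond [RHS]big_mkcond /=.
apply: eq_bigr => h _; rewrite !inE; case: eqP => //= _.
have [mj|mj] := boolP (tag (m h) == j).
  rewrite (bigD1 (m h)) ?inE //= eqxx big1 // => y /andP[_ ymh].
  by rewrite eq_sym (negbTE ymh).
rewrite big1 // => y; rewrite inE => yj; case: eqP => // mhy.
by rewrite mhy yj in mj.
Qed.

Lemma sum_half_count i j :
  (N.-1 * \sum_(m in P) half_count m i j <= adj_deg d i * adj_deg d j * #|P|)%N.
Proof.
under eq_bigr do rewrite half_countE.
rewrite exchange_big /= big_distrr /= -mulnA -[adj_deg d i]card_half_edges_at.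
rewrite -sum_nat_const; apply: leq_sum => h _.
rewrite exchange_big /= big_distrr /= -[adj_deg d j]card_half_edges_at.
rewrite -sum_nat_const; apply: leq_sum => y _.
apply: leq_trans (card_pairings1 h y); rewrite leq_mul2l; apply/orP; right.
rewrite -sum1_card big_mkcond [leqRHS]big_mkcond /=; apply: leq_sum => m _.
by rewrite !inE; case: ifP => //=; case: eqP.
Qed.

(** With [k] the number of edges, [(k - 1)^+ <= k (k - 1)], and the latter counts ordered pairs of
    distinct half-edges at [i] that are both matched into [j]. *)
Lemma half_count_pairs (m : {perm half_edge d}) i j :
  (half_count m i j - (0 < half_count m i j) <=
   \sum_(h1 in half_edges_at i) \sum_(h2 in half_edges_at i)
   \sum_(y1 in half_edges_at j) \sum_(y2 in half_edges_at j)
     ((h1 != h2) && (m h1 == y1) && (m h2 == y2)))%N.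
Proof.
pose H := [set h : half_edge d | (tag h == i) && (tag (m h) == j)]%SET.
rewrite half_count_card -/H.
apply: (@leq_trans (#|H| * #|H|.-1)); first by case: #|H| => // -[|k]//=; rewrite subn1 mulSn leq_addr.
have -> : (#|H| * #|H|.-1 = \sum_(h1 in H) \sum_(h2 in H) (h1 != h2))%N.
  rewrite -sum_nat_const; apply: eq_bigr => h1 h1H.
  rewrite (cardsD1 h1) h1H /= -sum1_card big_mkcond [RHS]big_mkcond /=.
  apply: eq_bigr => h _; rewrite !inE [h1 == h]eq_sym.
  by case: (h == h1) => //=; case: ifP.
have sub h : h \in H -> (h \in half_edges_at i) && (m h \in half_edges_at j).
  by rewrite !inE.
rewrite big_mkcond [leqRHS]big_mkcond /=; apply: leq_sum => h1 _.
case: ifP => // /sub/andP[-> mh1].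
rewrite big_mkcond [leqRHS]big_mkcond /=; apply: leq_sum => h2 _.
case: ifP => // /sub/andP[-> mh2].
by rewrite (bigD1 (m h1)) //= (bigD1 (m h2)) //= !eqxx !andbT -addnA leq_addr.
Qed.

Lemma sum_half_count_excess i j : i != j ->
  (N.-1 * (N - 3) * \sum_(m in P) (half_count m i j - (0 < half_count m i j)) <=
    (adj_deg d i * adj_deg d j) ^ 2 * #|P|)%N.
Proof.
move=> ij.
apply: (@leq_trans (N.-1 * (N - 3) * \sum_(m in P) \sum_(h1 in half_edges_at i)
   \sum_(h2 in half_edges_at i) \sum_(y1 in half_edges_at j)
   \sum_(y2 in half_edges_at j) ((h1 != h2) && (m h1 == y1) && (m h2 == y2)))).
  by rewrite leq_mul2l leq_sum ?orbT // => m _; exact: half_count_pairs.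
rewrite -mulnn mulnACA -!mulnA -[adj_deg d i]card_half_edges_at.
rewrite -[adj_deg d j]card_half_edges_at mulnA.
rewrite exchange_big /= big_distrr /= -sum_nat_const; apply: leq_sum => h1 h1i.
rewrite exchange_big /= big_distrr /= -sum_nat_const; apply: leq_sum => h2 h2i.
rewrite exchange_big /= big_distrr /= -sum_nat_const; apply: leq_sum => y1 y1j.
rewrite exchange_big /= big_distrr /= -sum_nat_const; apply: leq_sum => y2 y2j.
(* Here [i != j] is what keeps the four half-edges apart, as the two-pair count requires. *)
have ne h y : h \in half_edges_at i -> y \in half_edges_at j -> (h == y) = false.
  rewrite !inE => /eqP hi /eqP yj; apply/eqP => hy.
  by move: ij; rewrite -hi -yj hy eqxx.
have [h12|h12] := eqVneq h1 h2; first by rewrite big1 ?muln0.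
apply: leq_trans (@card_pairings2 _ h1 h2 y1 y2 _ _).
- rewrite leq_mul2l; apply/orP; right.
  rewrite -sum1_card big_mkcond [leqRHS]big_mkcond /=; apply: leq_sum => m _.
  by rewrite !inE; case: ifP => //= _; case: (_ && _).
- by rewrite /= !inE (negbTE h12) !(ne _ y1).
- by rewrite !inE ![y2 == _]eq_sym !(ne _ y2).
Qed.

End EdgeCounts.

(** * Interpolated bounds on the removed edges for fixed degrees *)

(** Since [1 <= s <= 2], [u <= u ^ s] for [u > 1] and [u ^ 2 <= u ^ s] for [u <= 1]. In the
    applications [q] is the number of pairings. *)
Lemma le_powR_of_le_sqr (R : realType) (u s e q : R) :
  0 <= u -> 1 <= s <= 2 -> 0 <= q -> e <= u * q -> e <= u ^+ 2 * q ->
  e <= u `^ s * q.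
Proof.
move=> u0 /andP[s1 s2] q0 e1 e2.
have [u1|u1] := leP u 1; last first.
  apply: le_trans e1 _; rewrite ler_wpM2r // -[leLHS]powRr1 //.
  by rewrite ler_powR // ltW.
apply: le_trans e2 _; rewrite ler_wpM2r // -powR_mulrn //.
have [->|un0] := eqVneq u 0; first by rewrite !powR0 //; lra.
by rewrite ger_powR // lt0r un0 u0.
Qed.

Section PairingBounds.
Variables (R : realType) (n : nat) (d : 'I_n -> nat) (s w : R).
Hypotheses (s12 : 1 <= s <= 2) (w0 : 0 < w) (wN : w + 3 <= #|half_edge d|%:R).
Let P := pairings (half_edge d).
Let b (i : 'I_n) : R := (d i).+1%:R.

Let adj_le i : (adj_deg d i)%:R <= b i.
Proof. by rewrite ler_nat /adj_deg -[leqRHS]addn1 leq_add2l leq_b1. Qed.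

Let b_ge0 i : 0 <= b i. Proof. exact: ler0n. Qed.

Let w_ge0 : 0 <= w. Proof. exact: ltW. Qed.
Let w_neq0 : w != 0. Proof. by rewrite gt_eqF. Qed.

(** The margin 3 in [wN] lets [w] replace both factors [N - 1] and [N - 3] of the counting
    bounds. *)
Let N1 : w <= #|half_edge d|.-1%:R.
Proof.
have := wN; case: #|half_edge d| => [|k] /=; first by lra.
by rewrite -natr1; lra.
Qed.

Let N3 : w <= (#|half_edge d| - 3)%:R.
Proof.
have N3 : (3 <= #|half_edge d|)%N.
  by rewrite -(ler_nat R); apply: le_trans wN; rewrite lerDr ltW.
by rewrite natrB // lerBrDr.
Qed.

Lemma sum_half_count_le i j :
  w * (\sum_(m in P) half_count m i j)%:R <= b i * b j * #|P|%:R.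
Proof.
apply: le_trans (ler_wpM2r (ler0n _ _) N1) _.
have := sum_half_count d i j; rewrite -(ler_nat R) !natrM => /le_trans; apply.
by rewrite ler_wpM2r ?ler0n // ler_pM ?ler0n.
Qed.

(** Interpolates with [u = b i / w], after division by [w]: the linear bound is the number of
    half-edges at [i], the quadratic one comes from the count of matched pairs. *)
Lemma sum_self_loops_le i :
  (\sum_(m in P) X_edges m i i)%:R <= w `^ (1 - s) * b i `^ s * #|P|%:R.
Proof.
set e := (X in X <= _).
have eh : e <= (\sum_(m in P) half_count m i i)%:R.
  rewrite ler_nat; apply: leq_sum => m _; rewrite /X_edges eqxx.
  by rewrite -divn2 leq_div.
have e1 : e <= b i * #|P|%:R.
  apply: le_trans eh _; apply: (@le_trans _ _ (adj_deg d i * #|P|)%:R).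
    rewrite ler_nat mulnC -sum_nat_const; apply: leq_sum => m _; exact: half_count_le.
  by rewrite natrM ler_wpM2r ?ler0n.
have e2 : w * e <= b i * b i * #|P|%:R.
  by apply: le_trans (sum_half_count_le i i); rewrite ler_wpM2l // ltW.
have : e / w <= (b i / w) `^ s * #|P|%:R.
  apply: le_powR_of_le_sqr => //; first by rewrite divr_ge0.
    by rewrite mulrAC ler_wpM2r // invr_ge0 ltW.
  have -> : e / w = w * e / w ^+ 2 by field.
  have -> : (b i / w) ^+ 2 * #|P|%:R = b i * b i * #|P|%:R / w ^+ 2.
    by field.
  by rewrite ler_wpM2r // invr_ge0 exprn_ge0 // ltW.
rewrite ler_pdivrMr // => /le_trans; apply.
rewrite powRM ?invr_ge0 // powRB; last first.
  by rewrite w_neq0 implybT.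
rewrite powRr1 // -powR_inv1 // -powRrM mulN1r powRN.
by rewrite le_eqVlt; apply/orP; left; apply/eqP; ring.
Qed.

(** Interpolates with [u = b i * b j / w]: the linear bound is the mean of the edge count, the
    quadratic one the bound on its excess over 1. *)
Lemma sum_multi_edges_le i j : i != j ->
  (\sum_(m in P) (X_edges m i j - (0 < X_edges m i j)))%:R <=
    w `^ (- s) * (b i `^ s * b j `^ s) * #|P|%:R.
Proof.
move=> ij; rewrite /X_edges (negbTE ij); set e := (X in X <= _).
have e1 : w * e <= b i * b j * #|P|%:R.
  apply: le_trans (sum_half_count_le i j); rewrite ler_wpM2l //.
  by rewrite ler_nat; apply: leq_sum => m _; exact: leq_subr.
have e2 : w ^+ 2 * e <= (b i * b j) ^+ 2 * #|P|%:R.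
  apply: (@le_trans _ _ ((#|half_edge d|.-1 * (#|half_edge d| - 3))%:R * e)).
    by rewrite ler_wpM2r ?ler0n // natrM expr2 ler_pM // ltW.
  have := sum_half_count_excess d ij; rewrite -(ler_nat R) [leLHS]natrM => /le_trans; apply.
  rewrite natrM ler_wpM2r // natrX lerXn2r ?nnegrE ?mulr_ge0 //.
  by rewrite natrM ler_pM.
have : e <= (b i * b j / w) `^ s * #|P|%:R.
  apply: le_powR_of_le_sqr => //; first by rewrite !mulr_ge0 // invr_ge0 ltW.
    by rewrite mulrAC ler_pdivlMr // mulrC.
  rewrite expr_div_n mulrAC ler_pdivlMr ?exprn_gt0 //; by rewrite mulrC.
move=> /le_trans; apply.
rewrite powRM ?mulr_ge0 ?invr_ge0 // powRM //.
rewrite -powR_inv1 // -powRrM mulN1r.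
by rewrite le_eqVlt; apply/orP; left; apply/eqP; ring.
Qed.

Lemma sum_removed_edges_le :
  (\sum_(m in P) removed_edges m)%:R <=
  (w `^ (1 - s) * (\sum_i b i `^ s) +
   w `^ (- s) * \sum_i \sum_(j | j != i) b i `^ s * b j `^ s) * #|P|%:R.
Proof.
rewrite big_split /= natrD mulrDl; apply: lerD.
  rewrite exchange_big /= natr_sum mulr_sumr mulr_suml.
  by apply: ler_sum => i _; exact: sum_self_loops_le.
rewrite exchange_big /= natr_sum mulr_sumr mulr_suml.
apply: ler_sum => i _; rewrite exchange_big /= natr_sum mulr_sumr mulr_suml.
(* The range [i < j] is enlarged to [j != i], at the cost of nonnegative terms only. *)
rewrite [leLHS]big_mkcond [leRHS]big_mkcond /=; apply: ler_sum => j _.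
have [-> /=|ji] := eqVneq j i; first by rewrite ltnn.
case: ifP => _; first by apply: sum_multi_edges_le; rewrite eq_sym.
by rewrite !mulr_ge0 ?powR_ge0.
Qed.

End PairingBounds.

(** * Probabilities under a uniform pairing *)

Section PairingProb.
Variables (R : realType) (n : nat) (d : 'I_n -> nat).
Let P := pairings (half_edge d).

Lemma pairing_probE E : pairing_prob R d E =
  #|[set m in P | E (removed_edges m)]%SET|%:R / #|P|%:R.
Proof.
rewrite /pairing_prob; congr (_%:R / _%:R); apply: eq_card => m.
  by rewrite [RHS]inE inE; apply/idP/idP => [/set_mem|/mem_set].
by rewrite [RHS]inE; apply/idP/idP => [/set_mem|/mem_set].
Qed.

Lemma pairing_prob_ge0 E : 0 <= pairing_prob R d E.
Proof. by rewrite divr_ge0. Qed.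

Lemma pairing_prob_le1 E : pairing_prob R d E <= 1.
Proof.
(* Existence of a pairing need not be shown: with none, the quotient is 0 by the convention on
   division by zero. *)
rewrite pairing_probE; have [->|P0] := eqVneq #|P| 0%N; first by rewrite invr0 mulr0.
rewrite ler_pdivrMr ?ltr0n ?lt0n // mul1r ler_nat.
by apply: subset_leq_card; apply/fintype.subsetP => m; rewrite inE => /andP[].
Qed.

Lemma pairing_prob_markov (E : nat -> bool) (x K : R) : 0 < x -> 0 <= K ->
  (forall z, E z -> x <= z%:R) ->
  (\sum_(m in P) removed_edges m)%:R <= K * #|P|%:R ->
  pairing_prob R d E <= K / x.
Proof.
move=> x0 K0 Ex sumK; rewrite pairing_probE.
have [->|P0] := eqVneq #|P| 0%N; first by rewrite invr0 mulr0 divr_ge0 // ltW.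
rewrite ler_pdivrMr ?ltr0n ?lt0n // mulrAC ler_pdivlMr //.
apply: le_trans sumK; rewrite -sum1_card !natr_sum mulr_suml.
rewrite big_mkcond [leRHS]big_mkcond /=; apply: ler_sum => m _.
rewrite [X in if X then _ else _]inE.
by case: ifP => [/andP[-> /Ex]|_]; [rewrite mul1r | case: ifP].
Qed.

End PairingProb.

(** * Averaging over independent degrees *)

Section IidDegrees.
Variables (R : realType) (p : nat -> R).
Hypothesis p_ge0 : forall k, 0 <= p k.

(* Any finite family of degree sequences lies in a box, so it suffices to bound the finite sums over boxes. *)
Lemma CM_prob_le n E (c : R) :
  (forall B, \sum_(f : {ffun 'I_n -> 'I_B})
     (\prod_i p (f i)) * pairing_prob R (fun i => f i : nat) E <= c) ->
  (CM_prob p n E <= c%:E)%E.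
Proof.
move=> cB; apply: ge_ereal_sup => _ [X [finX _] <-].
rewrite fsbig_finite //= -[X in (X <= _)%E]/(\sum_(d <- finmap.enum_fset (fset_set X)) _)%E.
set S := finmap.enum_fset _; rewrite sumEFin lee_fin.
pose G (d : 'I_n -> nat) := (\prod_i p (d i)) * pairing_prob R d E.
have G0 d : 0 <= G d by rewrite mulr_ge0 ?prodr_ge0 ?pairing_prob_ge0.
rewrite -[leLHS]/(\sum_(d <- S) G d).
pose B := (\max_(d <- S) \max_i d i).+1%N.
have dB d i : d \in S -> (d i < B)%N.
  by move=> dS; rewrite ltnS (leq_trans (leq_bigmax i)) // (leq_bigmax_seq _ dS).
pose emb (f : {ffun 'I_n -> 'I_B}) : {ffun 'I_n -> nat} := [ffun i => f i : nat].
have emb_inj : injective emb.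
  by move=> f g /ffunP fg; apply/ffunP => i; apply/val_inj; have := fg i; rewrite !ffunE.
have SE : perm_eq S [seq emb f | f <- enum [pred f | emb f \in S]].
  apply: uniq_perm; first exact: finmap.fset_uniq.
    by rewrite map_inj_uniq ?enum_uniq.
  move=> d; apply/idP/mapP => [dS|[f + ->]]; last by rewrite mem_enum.
  have dE : d = emb [ffun i => inord (d i)].
    by apply/ffunP => i; rewrite !ffunE inordK // dB.
  by exists [ffun i => inord (d i)] => //; rewrite mem_enum inE -dE.
rewrite (perm_big _ SE) /= big_map big_enum_cond /=.
apply: le_trans (cB B); rewrite [leLHS]big_mkcond /=; apply: ler_sum => f _.
have -> : (fun i => f i : nat) = emb f :> ('I_n -> nat).
  by apply/funext => i; rewrite ffunE.
have -> : \prod_i p (f i) = \prod_i p (emb f i).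
  by apply: eq_bigr => i _; rewrite ffunE.
by case: ifP => _; last exact: G0.
Qed.

(** Independence: over a box, the sum of a product factors into one sum per vertex. *)
Lemma sum_box_prod_le n B (F : 'I_n -> nat -> R) (M : 'I_n -> R) :
  (forall i k, 0 <= F i k) -> (forall i, \sum_(k < B) F i k <= M i) ->
  \sum_(f : {ffun 'I_n -> 'I_B}) \prod_i F i (f i) <= \prod_i M i.
Proof.
move=> F0 FM; rewrite -(bigA_distr_bigA (fun i (k : 'I_B) => F i k)).
by apply: ler_prod => i _; rewrite FM sumr_ge0.
Qed.

Variables (g : nat -> R) (M : R).
Hypotheses (g_ge0 : forall k, 0 <= g k)
  (p_le1 : forall B, \sum_(k < B) p k <= 1)
  (pg_le : forall B, \sum_(k < B) p k * g k <= M).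

(** Each vertex of [A] contributes a factor at most [M], every other vertex a total mass at most
    1. *)
Lemma sum_box_in_le n B (A : {set 'I_n}) :
  \sum_(f : {ffun 'I_n -> 'I_B}) (\prod_i p (f i)) * (\prod_(i in A) g (f i))
    <= M ^+ #|A|.
Proof.
under eq_bigr => f _ do rewrite [X in _ * X]big_mkcond -big_split /=.
rewrite -prodr_const [leRHS]big_mkcond.
apply: (@sum_box_prod_le n B (fun i k => p k * (if i \in A then g k else 1))).
  by move=> i k; rewrite mulr_ge0 //; case: ifP.
move=> i; case: ifP => _; first exact: pg_le.
by under eq_bigr do rewrite mulr1; exact: p_le1.
Qed.

Lemma sum_box1_le n B (i : 'I_n) :
  \sum_(f : {ffun 'I_n -> 'I_B}) (\prod_i p (f i)) * g (f i) <= M.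
Proof.
have := sum_box_in_le B [set i]%SET; rewrite cards1 expr1.
by under eq_bigr do rewrite big_set1.
Qed.

Lemma sum_box2_le n B (i j : 'I_n) : j != i ->
  \sum_(f : {ffun 'I_n -> 'I_B}) (\prod_i p (f i)) * (g (f i) * g (f j)) <= M ^+ 2.
Proof.
move=> ji; have := sum_box_in_le B [set i; j]%SET; rewrite cards2 eq_sym ji /=.
by under eq_bigr do rewrite big_setU1 ?inE 1?eq_sym // big_set1.
Qed.

(** Linearity of expectation. The double sum omits the diagonal, so only the first moment of [g]
    enters; a diagonal term would call for a second moment. *)
Lemma sum_box_mean_le n B (v w : R) : 0 <= v -> 0 <= w ->
  \sum_(f : {ffun 'I_n -> 'I_B}) (\prod_i p (f i)) *
    (v * (\sum_i g (f i)) + w * \sum_i \sum_(j | j != i) g (f i) * g (f j))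
  <= v * (n%:R * M) + w * (n%:R ^+ 2 * M ^+ 2).
Proof.
move=> v0 w0; have M0 : 0 <= M by have := pg_le 0; rewrite big_ord0.
under eq_bigr do rewrite mulrDr (mulrCA _ v) (mulrCA _ w).
rewrite big_split /= -!mulr_sumr lerD // ler_wpM2l //.
  under eq_bigr do rewrite mulr_sumr.
  rewrite exchange_big /= mulr_natl -[X in _ *+ X](card_ord n) -sumr_const.
  by apply: ler_sum => i _; exact: sum_box1_le.
under eq_bigr do rewrite mulr_sumr.
rewrite exchange_big /= expr2 -mulrA mulr_natl -[X in _ *+ X](card_ord n) -sumr_const.
apply: ler_sum => i _; under eq_bigr do rewrite mulr_sumr.
rewrite exchange_big /= mulr_natl -[X in _ *+ X](card_ord n) -sumr_const big_mkcond /=.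
apply: ler_sum => j _; case: ifP => ji; first exact: sum_box2_le.
by rewrite exprn_ge0.
Qed.

End IidDegrees.

(** * An explicit bound for fixed [n] *)

(** [q] bounds the Laplace transform of the degree at 1, so the first term is the Chernoff bound for
    a degree sum below [c n]; the second is Markov's bound at level [x]. *)
Lemma CM_prob_bound (R : realType) (p : nat -> R) (M s q c x : R) n (E : nat -> bool) :
  (forall k, 0 <= p k) ->
  (forall B, \sum_(k < B) p k <= 1) ->
  (forall B, \sum_(k < B) p k * k.+1%:R `^ s <= M) ->
  (forall B, \sum_(k < B) p k * expR (- k%:R) <= q) ->
  1 <= s <= 2 -> 6 <= c * n%:R -> 0 < x -> (forall z, E z -> x <= z%:R) ->
  (CM_prob p n E <=
   ((expR c * q) ^+ n +
    ((c * n%:R / 2) `^ (1 - s) * (n%:R * M) +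
     (c * n%:R / 2) `^ (- s) * (n%:R ^+ 2 * M ^+ 2)) / x)%:E)%E.
Proof.
(* Halving [c n] leaves room for the margin: [6 <= c n] gives [w + 3 <= c n]. *)
move=> p0 p1 pM pq s12 cn x0 Ex; set w := c * n%:R / 2.
have w0 : 0 < w by rewrite /w; lra.
pose g k : R := k.+1%:R `^ s.
have g0 k : 0 <= g k by exact: powR_ge0.
pose K (d : 'I_n -> nat) := w `^ (1 - s) * (\sum_i g (d i)) +
   w `^ (- s) * \sum_i \sum_(j | j != i) g (d i) * g (d j).
have K0 d : 0 <= K d.
  rewrite addr_ge0 ?mulr_ge0 ?powR_ge0 ?sumr_ge0 // => i _.
  by rewrite sumr_ge0 // => j _; rewrite mulr_ge0.
(* A pointwise bound avoids splitting the sum over degrees: when the degree sum is below [c n], the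
   exponential factor is at least 1 and dominates any probability. *)
have bad d : pairing_prob R d E <=
    expR c ^+ n * \prod_i expR (- (d i)%:R) + K d / x.
  have [big|small] := leP (c * n%:R) (\sum_i d i)%:R.
    apply: (@le_trans _ _ (K d / x)); last first.
      rewrite lerDr mulr_ge0 ?exprn_ge0 ?expR_ge0 //.
      by apply: prodr_ge0 => i _; exact: expR_ge0.
    apply: pairing_prob_markov => //.
    apply: sum_removed_edges_le => //.
    apply: (@le_trans _ _ (\sum_i d i)%:R); first by rewrite /w; lra.
    by rewrite ler_nat card_half_edge; apply: leq_sum => i _; exact: leq_addr.
  apply: le_trans (pairing_prob_le1 R d E) _.
  rewrite -[leLHS]addr0 lerD ?divr_ge0 // ?(ltW x0) //.
  rewrite -expR_sum -expRM_natl -expRD -[leLHS]expR0 ler_expR sumrN -natr_sum.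
  by rewrite mulrC subr_ge0 ltW.
apply: CM_prob_le => // B.
apply: (@le_trans _ _ (expR c ^+ n * (\sum_(f : {ffun 'I_n -> 'I_B})
   \prod_i (p (f i) * expR (- (f i)%:R))) +
   (\sum_(f : {ffun 'I_n -> 'I_B}) (\prod_i p (f i)) * K (fun i => f i)) / x)).
  rewrite mulr_sumr mulr_suml -big_split /=; apply: ler_sum => f _.
  by rewrite big_split /= [X in X + _]mulrCA -[X in _ + X]mulrA -mulrDr ler_wpM2l ?prodr_ge0.
rewrite lerD //.
  rewrite exprMn ler_wpM2l ?exprn_ge0 ?expR_ge0 // -[X in q ^+ X](card_ord n) -prodr_const.
  apply: (@sum_box_prod_le _ n B (fun _ k => p k * expR (- k%:R))) => // i k.
  by rewrite mulr_ge0 ?expR_ge0.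
rewrite ler_wpM2r ?invr_ge0 ?(ltW x0) //.
by apply: sum_box_mean_le; rewrite ?powR_ge0.
Qed.

(** * Laplace transform, tails and moments of the degree law *)

Section DegreeTail.
Variables (R : realType) (p : nat -> R).
Hypothesis p_ge0 : forall k, 0 <= p k.

Lemma sum_le_esum (P : pred nat) (x : R) B :
  \esum_(k in [set k | P k]) (p k)%:E = x%:E -> \sum_(k < B | P k) p k <= x.
Proof.
move=> Px; rewrite -lee_fin -Px -sumEFin.
rewrite -(big_mkord P (fun k => (p k)%:E)) -big_filter.
rewrite fsbig_seq ?filter_uniq ?iota_uniq //; apply: esum_ge.
eexists; last exact: lexx.
by split; [exact: finite_seq | move=> k /=; rewrite mem_filter => /andP[]].
Qed.

Hypothesis p_sum1 : \esum_(k in [set: nat]) (p k)%:E = 1%E.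

Lemma sum_pmf_le1 B : \sum_(k < B) p k <= 1.
Proof. by apply: (@sum_le_esum xpredT); rewrite -[RHS]p_sum1; congr esum; apply/seteqP. Qed.

Lemma laplace_pmf_lt1 : (exists2 k, (0 < k)%N & 0 < p k) ->
  exists2 q : R, 0 < q < 1 & forall B, \sum_(k < B) p k * expR (- k%:R) <= q.
Proof.
move=> [k0 k0_gt0 pk0].
have pk1 : p k0 <= 1.
  by apply: le_trans (sum_pmf_le1 k0.+1); rewrite big_ord_recr /= lerDr sumr_ge0.
have ek0 : 0 < expR (- k0%:R : R) < 1.
  by rewrite expR_gt0 expR_lt1 oppr_lt0 ltr0n.
(* Total mass 1 minus the loss caused by the atom at [k0] alone. *)
exists (1 - p k0 * (1 - expR (- k0%:R))); first by apply/andP; split; nra.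
have e1 k : 0 <= 1 - expR (- k%:R) :> R.
  by rewrite subr_ge0 -[leRHS]expR0 ler_expR oppr_le0.
(* The range is lengthened so that it contains [k0]. *)
move=> B; apply: (@le_trans _ _ (\sum_(k < B + k0.+1) p k * expR (- k%:R))).
  by rewrite big_split_ord /= lerDl sumr_ge0 // => k _; rewrite mulr_ge0 ?expR_ge0.
rewrite lerBrDr; apply: le_trans (sum_pmf_le1 (B + k0.+1)).
have k0lt : (k0 < B + k0.+1)%N by rewrite addnS ltnS leq_addl.
rewrite (bigD1 (Ordinal k0lt)) //= [leRHS](bigD1 (Ordinal k0lt)) //=.
rewrite addrAC -mulrDr [_ + (1 - _)]addrC subrK mulr1 lerD2l.
by apply: ler_sum => k _; rewrite ler_piMr // -subr_ge0.
Qed.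

Lemma geometric_sum_le (x : R) B : 0 <= x < 1 -> \sum_(j < B) x ^+ j <= (1 - x)^-1.
Proof.
move=> /andP[x0 x1]; rewrite -[leRHS]mul1r ler_pdivlMr ?subr_gt0 //.
have -> : (\sum_(j < B) x ^+ j) * (1 - x) = 1 - x ^+ B.
  by rewrite -[RHS]opprB subrX1 -mulNr opprB mulrC.
by rewrite lerBlDr lerDl exprn_ge0.
Qed.

(** For [k >= 2] a single term suffices: if [2 ^ j < k <= 2 ^ (j + 1)], then [k + 1 <= 4 * 2 ^ j].
    The sum form makes tail probabilities appear once it is averaged over [k]. *)
Lemma powR_le_dyadic_sum (s : R) B k : 0 <= s -> (k < B)%N ->
  k.+1%:R `^ s <= 2 `^ s + \sum_(j < B | (2 ^ j < k)%N) 4 `^ s * (2 `^ s) ^+ j.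
Proof.
move=> s0 kB.
have sum0 : 0 <= \sum_(j < B | (2 ^ j < k)%N) 4 `^ s * (2 `^ s) ^+ j :> R.
  by apply: sumr_ge0 => j _; rewrite mulr_ge0 ?exprn_ge0 ?powR_ge0.
have [k1|k2] := leqP k 1.
  rewrite -[leLHS]addr0 lerD // ge0_ler_powR ?nnegrE //.
  by rewrite (ler_nat R _ 2).
(* The logarithm is that of [k - 1] because [2 ^ j < k] must be strict. *)
have /(trunc_log_bounds (isT : 1 < 2)%N) : (0 < k.-1)%N by case: k k2 {kB sum0} => [|[]].
set j := trunc_log 2 _ => /andP[jk kj].
have jk' : (2 ^ j < k)%N by rewrite -[k]prednK ?ltnS // (ltn_trans _ k2).
have jB : (j < B)%N by rewrite (ltn_trans _ kB) // (ltn_trans _ jk') // ltn_expl.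
rewrite (bigD1 (Ordinal jB)) //= addrCA -[leLHS]addr0 lerD //; last first.
  apply: addr_ge0; first exact: powR_ge0.
  by apply: sumr_ge0 => i _; rewrite mulr_ge0 ?exprn_ge0 ?powR_ge0.
have -> : (2 `^ s) ^+ j = (2 ^+ j) `^ s :> R.
  by rewrite -powR_mulrn ?powR_ge0 // -powRrM mulrC powRrM powR_mulrn.
rewrite -powRM ?exprn_ge0 // ge0_ler_powR ?nnegrE ?mulr_ge0 ?exprn_ge0 //.
rewrite -natrX -natrM ler_nat.
have : (0 < 2 ^ j)%N by rewrite expn_gt0.
by move: kj; rewrite expnS; lia.
Qed.

(** Averaging the dyadic bound and exchanging the sums leaves a geometric series of ratio
    [2 ^ s * r]. *)
Lemma moment_le (s r C : R) : 0 <= s -> 0 <= C -> 0 <= r -> 2 `^ s * r < 1 ->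
  (forall B j, \sum_(k < B | (2 ^ j < k)%N) p k <= C * r ^+ j) ->
  forall B, \sum_(k < B) p k * k.+1%:R `^ s <=
    2 `^ s + 4 `^ s * C / (1 - 2 `^ s * r).
Proof.
move=> s0 C0 r0 sr1 tail B.
apply: (@le_trans _ _ (\sum_(k < B) p k * (2 `^ s +
    \sum_(j < B | (2 ^ j < k)%N) 4 `^ s * (2 `^ s) ^+ j))).
  by apply: ler_sum => k _; rewrite ler_wpM2l // powR_le_dyadic_sum.
under eq_bigr do rewrite mulrDr.
rewrite big_split /=; apply: lerD.
  by rewrite -mulr_suml ler_piMl ?powR_ge0 // sum_pmf_le1.
under eq_bigr do rewrite mulr_sumr big_mkcond.
rewrite exchange_big /=.
apply: (@le_trans _ _ (\sum_(j < B) 4 `^ s * C * (2 `^ s * r) ^+ j)).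
  apply: ler_sum => j _; rewrite -big_mkcond -mulr_suml.
  have -> : 4 `^ s * C * (2 `^ s * r) ^+ j = C * r ^+ j * (4 `^ s * (2 `^ s) ^+ j).
    by rewrite exprMn; ring.
  rewrite ler_wpM2r ?mulr_ge0 ?exprn_ge0 ?powR_ge0 //.
  exact: tail.
rewrite -mulr_sumr ler_wpM2l ?mulr_ge0 ?powR_ge0 //.
by apply: geometric_sum_le; rewrite sr1 mulr_ge0 ?powR_ge0.
Qed.

Variables (gamma : R) (L : R -> R).
Hypotheses (L_sv : slowly_varying L)
  (tailL : forall t : R, 0 < t ->
     \esum_(k in [set k : nat | t < k%:R]) (p k)%:E = (L t * t `^ (- gamma))%:E).

(** Without positive mass off 0 all tails would vanish, whereas [L] is positive at large
    arguments. *)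
Lemma pmf_pos : exists2 k, (0 < k)%N & 0 < p k.
Proof.
have [_ [[t0 [_ Lpos]] _]] := L_sv.
pose t := Num.max t0 0 + 1.
have t_gt0 : 0 < t by rewrite ltr_pwDr // le_max lexx orbT.
have /Lpos Lt : t0 < t by rewrite ltr_pwDr // le_max lexx.
apply: contrapT => nk; have := tailL t_gt0; rewrite esum1.
  by move=> /eqP; rewrite eq_sym eqe gt_eqF // mulr_gt0 ?powR_gt0.
move=> k /= tk; congr EFin; apply/eqP; rewrite eq_le p_ge0 andbT leNgt.
apply/negP => pk; apply: nk; exists k => //.
by rewrite -(ltr0n R) (lt_trans t_gt0).
Qed.

(* Slow variation along t = 2 ^ j makes the dyadic tails decay geometrically with any ratio above 2 ^ - gamma. *)
Lemma dyadic_tail_le (r : R) : 2 `^ (- gamma) < r -> r < 1 ->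
  exists2 C : R, 0 <= C &
    forall B j, \sum_(k < B | (2 ^ j < k)%N) p k <= C * r ^+ j.
Proof.
move=> gr r1; have r0 : 0 < r by rewrite (lt_trans _ gr) ?powR_gt0.
have [_ [Lpos /(_ 2 ltac:(by [])) L2]] := L_sv.
(* [rho > 1] is the growth of [L] per doubling that a tail ratio of [r] tolerates. *)
pose rho := r / 2 `^ (- gamma).
have rho1 : 1 < rho by rewrite ltr_pdivlMr ?mul1r ?powR_gt0.
have [x0 [_ x0P]] : \forall x \near +oo, 0 < L x /\ L (2 * x) / L x <= rho.
  near=> x; split; first by near: x.
  apply: ltW; near: x.
  by apply: (cvgr_lt _ L2).
pose T j : R := L (2 ^+ j) * (2 ^+ j) `^ (- gamma).
have [j0 j0P] : exists j0, forall j, (j0 <= j)%N -> x0 < 2 ^+ j.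
  exists (Num.truncn x0).+1 => j; rewrite -(ler_nat R) => jl.
  apply: lt_le_trans (truncnS_gt _) _; apply: le_trans jl _.
  by rewrite -natrX ler_nat ltnW // ltn_expl.
have T0 : 0 <= T j0 by rewrite mulr_ge0 ?powR_ge0 // ltW //; have [] := x0P _ (j0P _ (leqnn _)).
have Tle i : T (j0 + i)%N <= T j0 * r ^+ i.
  elim: i => [|i IH]; first by rewrite addn0 expr0 mulr1.
  rewrite addnS exprSr mulrA; apply: le_trans (ler_wpM2r (ltW r0) IH).
  have [L0 Lr] := x0P _ (j0P _ (leq_addr i j0)).
  rewrite /T exprS powRM // ?exprn_ge0 //.
  rewrite ler_pdivrMr // in Lr.
  have -> : r = rho * 2 `^ (- gamma) by rewrite divfK ?gt_eqF ?powR_gt0.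
  rewrite [leRHS]mulrACA [_ * rho]mulrC [X in _ <= _ * X]mulrC.
  by rewrite ler_wpM2r ?mulr_ge0 ?powR_ge0.
(* [T j0] serves the scales [j >= j0]; the summand 1 serves the earlier ones, where the tail is at
   most 1 and [r ^ j0 <= r ^ j]. *)
exists ((1 + T j0) / r ^+ j0).
  by rewrite divr_ge0 ?exprn_ge0 ?addr_ge0 // ltW.
move=> B j; rewrite mulrAC ler_pdivlMr ?exprn_gt0 //.
have [jj|jj] := leqP j0 j.
  have tl : \sum_(k < B | (2 ^ j < k)%N) p k <= T j.
    apply: (@sum_le_esum (fun k => 2 ^ j < k)%N).
    rewrite /T -tailL ?exprn_gt0 //; congr esum; apply/seteqP.
    by split=> k /=; rewrite -natrX ltr_nat.
  have := Tle (j - j0)%N; rewrite subnKC // => Tj.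
  rewrite -[in leRHS](subnK jj) exprD mulrA ler_wpM2r ?exprn_ge0 ?(ltW r0) //.
  apply: le_trans tl (le_trans Tj _); rewrite ler_wpM2r ?exprn_ge0 ?(ltW r0) //.
  by rewrite lerDr.
apply: (@le_trans _ _ (1 * r ^+ j)).
  apply: ler_pM; rewrite ?exprn_ge0 ?sumr_ge0 ?(ltW r0) //.
    apply: le_trans (sum_pmf_le1 B); rewrite [leLHS]big_mkcond /=.
    by apply: ler_sum => k _; case: ifP.
  by apply: ler_wiXn2l; [exact: ltW | exact: ltW | exact: ltnW].
by rewrite ler_wpM2r ?exprn_ge0 ?(ltW r0) // lerDl.
Unshelve. all: by end_near. Qed.

Lemma moment_fin (s : R) : 0 < s < gamma ->
  exists M : R, forall B, \sum_(k < B) p k * k.+1%:R `^ s <= M.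
Proof.
(* The midpoint exponent gives both [2 ^ (- gamma) < r] and [2 ^ s * r < 1]. *)
move=> /andP[s0 sg]; pose r : R := 2 `^ (- ((s + gamma) / 2)).
have lt2 (a b : R) : a < b -> 2 `^ a < 2 `^ b :> R.
  by move=> ab; rewrite /powR pnatr_eq0 /= ltr_expR ltr_pM2r // ln_gt0 // ltr1n.
have [C C0 tail] : exists2 C : R, 0 <= C &
    forall B j, \sum_(k < B | (2 ^ j < k)%N) p k <= C * r ^+ j.
  apply: dyadic_tail_le; first by apply: lt2; lra.
  by rewrite -[ltRHS](powRr0 2); apply: lt2; lra.
eexists; apply: (moment_le (ltW s0) C0 (powR_ge0 _ _) _ tail).
rewrite /r -powRD; last by rewrite pnatr_eq0 implybT.
by rewrite -[ltRHS](powRr0 2); apply: lt2; lra.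
Qed.

End DegreeTail.

(** * Passage to the limit *)

Lemma cvg_natr_powRN (R : realType) (a : R) : 0 < a ->
  (n%:R `^ (- a) : R) @[n --> \oo] --> (0 : R).
Proof.
move=> a0; apply/cvgrPdist_lt => e e0; near=> n.
rewrite sub0r normrN ger0_norm ?powR_ge0 // powRN.
have en : e^-1 `^ a^-1 < n%:R by near: n; exact: nbhs_infty_gtr.
have : (e^-1 `^ a^-1) `^ a < n%:R `^ a.
  by rewrite gt0_ltr_powR ?nnegrE ?powR_ge0.
rewrite -powRrM mulVf ?gt_eqF // powRr1 ?invr_ge0 ?(ltW e0) // => ena.
rewrite -[ltRHS]invrK ltf_pV2 ?posrE ?invr_gt0 //.
by apply: lt_trans ena; rewrite invr_gt0.
Unshelve. all: by end_near. Qed.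

Theorem theorem2p1 (R : realType) (p : nat -> R) (gamma : R)
  (p_ge0 : forall k, 0 <= p k)
  (p_sum1 : (\esum_(k in [set: nat]) (p k)%:E = 1)%E)
  (hgamma : 1 < gamma < 2)
  (htail : exists L : R -> R, slowly_varying L /\
     forall t : R, 0 < t ->
       (\esum_(k in [set k : nat | (t < k%:R)%R]) (p k)%:E)%E = (L t * t `^ (- gamma))%:E) :
  forall delta : R, 0 < delta -> forall eps : R, 0 < eps ->
    (fun n : nat =>
       CM_prob p n (fun z : nat => eps < z%:R / n%:R `^ (2 - gamma + delta)))
      @ \oo --> 0%E.
Proof.
move=> delta delta0 eps eps0; have [L [L_sv tailL]] := htail.
have [g1 g2] := andP hgamma.
(* Interpolation needs [s >= 1], a finite moment [s < gamma], and the final rate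
   [gamma - s < delta]. *)
pose s := Num.max 1 (gamma - delta / 2).
have [s1 sg sd] : [/\ 1 <= s, s < gamma & gamma - delta / 2 <= s].
  by rewrite /s !le_max gt_max !lexx orbT g1 gtrBl divr_gt0.
have [M MP] := moment_fin p_ge0 p_sum1 L_sv tailL (s := s) ltac:(apply/andP; split; lra).
have [q /andP[q0 q1] qP] := laplace_pmf_lt1 p_ge0 p_sum1 (pmf_pos p_ge0 L_sv tailL).
(* With this choice [expR c * q] is the square root of [q], hence below 1. *)
pose c := - ln q / 2.
have lnq : ln q < 0 by rewrite ln_lt0 // q0.
have c0 : 0 < c by rewrite /c; lra.
have cq : 0 <= expR c * q < 1.
  rewrite mulr_ge0 ?expR_ge0 ?(ltW q0) //= -[X in _ * X]lnK ?posrE // -expRD.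
  by rewrite expR_lt1 /c; lra.
(* The surplus exponent: [n ^ (2 - s) / n ^ (2 - gamma + delta) = n ^ (- a)]. *)
pose a := delta - (gamma - s).
have a0 : 0 < a by rewrite /a; lra.
pose K := ((c / 2) `^ (1 - s) * M + (c / 2) `^ (- s) * M ^+ 2) / eps.
have c20 : 0 <= c / 2 by rewrite divr_ge0 // ltW.
apply: (@squeeze_cvge _ _ _ _ (fun=> 0%E) _
  (fun n => ((expR c * q) ^+ n + K * n%:R `^ (- a))%:E)).
- near=> n; apply/andP; split.
    apply: esum_ge0 => d _; rewrite lee_fin mulr_ge0 ?pairing_prob_ge0 //.
    exact: prodr_ge0.
  have n0 : (0 : R) < n%:R by near: n; exact: nbhs_infty_gtr.
  have cn : 6 <= c * n%:R.
    by rewrite -ler_pdivrMl // mulrC ltW //; near: n; exact: nbhs_infty_gtr.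
  have x0 : 0 < eps * n%:R `^ (2 - gamma + delta) by rewrite mulr_gt0 ?powR_gt0.
  have s12 : 1 <= s <= 2 by rewrite s1 /=; lra.
  apply: (le_trans (CM_prob_bound p_ge0 (sum_pmf_le1 p_sum1) MP qP s12 cn x0 _)).
    by move=> z; rewrite ltr_pdivlMr ?powR_gt0 // => /ltW.
  (* The remaining terms are in fact equal, since [(c n / 2) ^ (1 - s) * n] and
     [(c n / 2) ^ (- s) * n ^ 2] both scale as [n ^ (2 - s)]. *)
  rewrite lee_fin lerD2l le_eqVlt; apply/orP; left; apply/eqP.
  have nD u v : n%:R `^ (u + v) = n%:R `^ u * n%:R `^ v :> R.
    by rewrite powRD // (gt_eqF n0) implybT.
  have cnE u : (c * n%:R / 2) `^ u = (c / 2) `^ u * n%:R `^ u.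
    by rewrite mulrAC powRM.
  have -> : - a = (- s + 2%:R) - (2 - gamma + delta) by rewrite /a; ring.
  rewrite !cnE (nD _ (- (2 - gamma + delta))) !(nD _ (- s)) (nD (- s)) (powRN _ (2 - _ + _)).
  rewrite powRr1 ?(ltW n0) // powR_mulrn ?(ltW n0) // /K.
  by field; rewrite !gt_eqF ?powR_gt0.
- exact: cvg_cst.
- rewrite -[X in _ --> X]/((0 : R)%:E); apply: cvg_EFin; first by near=> n.
  rewrite -[X in _ --> X]addr0; apply: cvgD.
    by apply: cvg_expr; have [? ?] := andP cq; rewrite ger0_norm.
  rewrite -[X in _ --> X](mulr0 K); apply: cvgMr.
  exact: cvg_natr_powRN.
Unshelve. all: by end_near. 
Qed.
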